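(* For each integer $n\geq 1$ and each integer $0\leq j\leq n-1$, $$\det(I_n-A_{C_n^j}^t)\leq 0.$$ In particular, $\det(I_n-A_{C_n^j}^t)=-H_j(n)$ for every such pair $n,j$.
   Context: $C_n^j$ is the directed graph with $n$ vertices $v_1,\dots,v_n$ and $2n$ edges $e_1,\dots,e_n,f_1,\dots,f_n$, where $e_i$ goes from $v_i$ to $v_{i+1}$ and $f_i$ goes from $v_i$ to $v_{i+j}$ (subscripts mod $n$). The incidence matrix $A_{C_n^j}$ is the $n\times n$ matrix whose $(i,k)$ entry is the number of edges from $v_i$ to $v_k$; $A^t$ denotes the transpose. $H_j(n)$ denotes the integer $|\det(I_n-A_{C_n^j}^t)|$. *)

(* Defs.v *)
From HB Require Import structures.
From mathcomp Require Import all_boot all_order all_algebra.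

Set Implicit Arguments.
Unset Strict Implicit.
Unset Printing Implicit Defensive.

Import Order.TTheory GRing.Theory Num.Theory.
Local Open Scope ring_scope.

(* Finite directed graphs on the vertex set 'I_n; loops and parallel edges are
   allowed. *)
Record digraph (n : nat) := Digraph {
  edge : finType;
  src : edge -> 'I_n;
  tgt : edge -> 'I_n
}.

Definition incidence (n : nat) (E : digraph n) : 'M[int]_n :=
  \matrix_(i < n, k < n) (#|[set e : edge E | (src e == i) && (tgt e == k)]|)%:Z.

Lemma shift_subproof (n : nat) (i : 'I_n) (j : nat) : ((i + j) %% n < n)%N.
Proof. by rewrite ltn_pmod // (leq_ltn_trans _ (ltn_ord i)). Qed.

Definition shift (n : nat) (j : nat) (i : 'I_n) : 'I_n :=
  Ordinal (shift_subproof i j).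

(* The vertices v_1, ..., v_n are numbered from 0, which does not affect the
   subscripts mod n. The edge [inl i] is e_i and the edge [inr i] is f_i. *)
Definition Cgraph (n j : nat) : digraph n :=
  @Digraph n ('I_n + 'I_n)%type
    (fun e => match e with inl i => i | inr i => i end)
    (fun e => match e with inl i => shift 1 i | inr i => shift j i end).

Definition H (j n : nat) : int :=
  `| \det (1%:M - (incidence (Cgraph n j))^T) |.

(* Main.v *)
Require Import Defs.
From mathcomp Require Import all_boot all_order all_algebra all_field.

(** The matrix [1 - A] is circulant: with P the cyclic shift it equals
    1 - P - P^j.  Its eigenvectors are the columns of the Vandermonde matrix of
    the n-th roots of unity w, with eigenvalues 1 - w - w^j, so the determinant
    is the product of these numbers ([det_Cgraph]).

    The root w = 1 contributes -1.  Complex conjugation pairs the eigenvalue at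
    w with the eigenvalue at w^-1, and each such pair contributes a squared
    modulus.  The only other root fixed by the pairing is w = -1, present when
    n is even, and it contributes 2 - (-1)^j, which is positive.  Hence the
    factors with w <> 1 have a nonnegative product ([prod_conj_pairs_ge0]) and
    the determinant is nonpositive. *)

Import Order.TTheory GRing.Theory Num.Theory.
Local Open Scope ring_scope.

Lemma incidence_Cgraph (n j : nat) (i k : 'I_n) :
  incidence (Cgraph n j) i k = (shift 1 i == k)%:Z + (shift j i == k)%:Z.
Proof.
rewrite mxE -PoszD; congr Posz.
rewrite cardsE -sum1_card big_sumType /=.
by congr (_ + _)%N; rewrite big_mkcondr big_pred1_eq; case: (_ == k).
Qed.

(** This makes the characters of Z/n visible as eigenvectors: a character v
    multiplies by a constant along each of the two shifts. *)
Lemma sum_incidence_Cgraph (R : pzRingType) (n j : nat) (i : 'I_n)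
    (v : 'I_n -> R) :
  \sum_k (incidence (Cgraph n j) i k)%:~R * v k = v (shift 1 i) + v (shift j i).
Proof.
have pick1 (a : 'I_n) : \sum_k ((a == k)%:Z)%:~R * v k = v a.
  rewrite (bigD1 a) //= eqxx mul1r big1 ?addr0 // => k.
  by rewrite eq_sym => /negPf ->; rewrite mul0r.
under eq_bigr => k _ do rewrite incidence_Cgraph intrD mulrDl.
by rewrite big_split /= !pick1.
Qed.

(** The product over the eigenvalues is obtained from M V = V D by cancelling
    det V, where V is the Vandermonde matrix of the distinct powers of z and D
    is diagonal. *)
Lemma det_Cgraph (R : idomainType) (n j : nat) (z : R) :
  n.-primitive_root z ->
  (\det (1%:M - incidence (Cgraph n j)))%:~R =
    \prod_(k < n) (1 - z ^+ k - z ^+ k ^+ j).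
Proof.
move=> z_prim; pose a : 'rV[R]_n := \row_k z ^+ k.
pose d : 'rV[R]_n := \row_k (1 - z ^+ k - z ^+ k ^+ j).
have detV0 : \det (Vandermonde n a) != 0.
  rewrite det_Vandermonde; apply/prodf_neq0 => i _; apply/prodf_neq0 => k ltik.
  rewrite !mxE subr_eq0 (eq_prim_root_expr z_prim) !modn_small //.
  by rewrite gtn_eqF.
have -> : \prod_(k < n) (1 - z ^+ k - z ^+ k ^+ j) = \det (diag_mx d).
  by rewrite det_diag; apply: eq_bigr => k _; rewrite mxE.
apply: (mulIf detV0); rewrite [RHS]mulrC -det_mulmx -det_map_mx -det_mulmx.
congr (\det _); rewrite mul_mx_diag map_mxB map_mx1 mulmxBl mul1mx.
apply/matrixP => i k; rewrite !mxE.
rewrite (eq_bigr (fun l : 'I_n =>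
    (incidence (Cgraph n j) i l)%:~R * z ^+ k ^+ l)); last first.
  by move=> l _; rewrite [map_mx _ _ _ _]mxE [Vandermonde _ _ _ _]mxE [a _ _]mxE.
have /= -> := sum_incidence_Cgraph R n j i (fun l => z ^+ k ^+ l).
(* As z ^+ n = 1, the exponent of z ^+ k may be reduced mod n. *)
have shiftE s : z ^+ k ^+ shift s i = z ^+ k ^+ i * z ^+ k ^+ s.
  by rewrite -exprD ![z ^+ k ^+ _]exprAC /= (prim_expr_mod z_prim).
by rewrite !shiftE expr1 !mulrBr mulr1 opprD addrA.
Qed.

(** Peeling off both ends of the range at once gives f 0 times its conjugate,
    a squared modulus, and leaves a shorter range with the same symmetry; an odd
    range ends with its self-paired middle factor. *)
Lemma prod_conj_pairs_ge0 (C : numClosedFieldType) (m : nat) (f : nat -> C) :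
  (forall k l, (k + l).+1 = m -> f l = (f k)^*) ->
  (forall k, (k + k).+1 = m -> 0 <= f k) ->
  0 <= \prod_(k < m) f k.
Proof.
elim/ltn_ind: m f => -[|[|m]] IHm f fJ f_mid; first by rewrite big_ord0 ler01.
  by rewrite big_ord1 f_mid.
rewrite big_ord_recl big_ord_recr /= mulrCA mulrC.
rewrite (fJ 0 m.+1) // -normCK mulr_ge0 ?exprn_ge0 //.
apply: (IHm m (leqnSn m.+1) (fun k => f k.+1)) => [k l klm|k kkm].
  by apply: fJ; rewrite addSn addnS klm.
by apply: f_mid; rewrite addSn addnS kkm.
Qed.

Lemma eigenvalue_at_N1_ge0 (R : numDomainType) (j : nat) :
  0 <= 1 - (-1) - (-1) ^+ j :> R.
Proof.
by rewrite opprK -signr_odd; case: odd; rewrite ?opprK ?addrK ?addr_ge0 ?ler01.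
Qed.

(** An n-th root of unity has modulus 1, so its inverse is its conjugate. *)
Lemma conj_unity_root (C : numClosedFieldType) (n : nat) (w w' : C) :
  (0 < n)%N -> w ^+ n = 1 -> w * w' = 1 -> w' = w^*.
Proof.
move=> n_gt0 wn1 ww'; have w0 : w != 0.
  by apply/eqP => w0; move/eqP: wn1; rewrite w0 expr0n gtn_eqF // eq_sym oner_eq0.
apply: (mulfI w0); rewrite ww' -normCK.
suff -> : `|w| = 1 by rewrite expr1n.
by apply/eqP; rewrite -(pexpr_eq1 n_gt0) // -normrX wn1 normr1.
Qed.

Lemma det_Cgraph_le0 (n j : nat) :
  (0 < n)%N -> \det (1%:M - incidence (Cgraph n j)) <= 0.
Proof.
case: n => // m _; have [z z_prim] := C_prim_root_exists (ltn0Sn m).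
rewrite -(ler_int algC) (det_Cgraph _ _ j _ z_prim) big_ord_recl /= expr0 expr1n.
rewrite subrr sub0r mulN1r oppr_le0.
pose f k : algC := 1 - z ^+ k.+1 - z ^+ k.+1 ^+ j.
have zpow k l : (k + l).+1 = m -> z ^+ k.+1 * z ^+ l.+1 = 1.
  by move=> klm; rewrite -exprD addSn addnS klm prim_expr_order.
apply: (@prod_conj_pairs_ge0 _ m f) => [k l /zpow zkl|k km]; rewrite /f.
  rewrite (@conj_unity_root _ m.+1 (z ^+ k.+1) (z ^+ l.+1)) //.
    by rewrite !rmorphB rmorph1 !rmorphXn.
  by rewrite exprAC (prim_expr_order z_prim) expr1n.
(* The square of this power of z is 1, and primitivity excludes the root 1. *)
have := zpow _ _ km; rewrite -expr2 => /eqP; rewrite sqrf_eq1.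
rewrite -(prim_order_dvd z_prim) gtnNdvd //=; last first.
  by rewrite ltnS -km ltnS leq_addr.
by move=> /eqP ->; apply: eigenvalue_at_N1_ge0.
Qed.

Theorem proposition2p5 (n j : nat) (hn : (1 <= n)%N) (hj : (0 <= j <= n - 1)%N) :
  \det (1%:M - (incidence (Cgraph n j))^T) <= 0 /\
  \det (1%:M - (incidence (Cgraph n j))^T) = - H j n.
Proof.
have det_le0 : \det (1%:M - (incidence (Cgraph n j))^T) <= 0.
  by rewrite -[1%:M]trmx1 -linearB det_tr det_Cgraph_le0.
by split=> //; rewrite /H ler0_norm // opprK.
Qed.
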